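(* Let $\mathcal{C}$ be a braided monoidal category, let $\tilde H=(H,\alpha,\tilde m_H,\eta_H,\tilde\Delta_H,\varepsilon_H)$ be a bialgebra in $\widetilde{\mathcal{H}}(\mathcal{C})$, and let $(V,\nu)$ be an object of $\widetilde{\mathcal{H}}(\mathcal{C})$. Regard $(H\otimes V,\alpha\otimes\nu)$ as a left $\tilde H$-Hopf module with the canonical action $(\tilde m_H\otimes id_V)\circ\tilde a^{-1}_{H,H,V}:H\otimes(H\otimes V)\to H\otimes V$ and the canonical coaction $\tilde a_{H,H,V}\circ(\tilde\Delta_H\otimes id_V):H\otimes V\to H\otimes(H\otimes V)$. Then there is a bijection between right $\tilde H$-module structures making $(H\otimes V,\alpha\otimes\nu)$ a left-covariant $\tilde H$-bimodule and right $\tilde H$-module structures on $(V,\nu)$.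
   Context: For a monoidal category $\mathcal{C}=(\mathcal{C},\otimes,I,a,l,r)$, $\widetilde{\mathcal{H}}(\mathcal{C})$ is the category of pairs $(A,\alpha)$ with $A\in\mathcal{C}$, $\alpha\in\mathrm{Aut}_{\mathcal{C}}(A)$, morphisms $f:(A,\alpha)\to(B,\beta)$ being morphisms $f:A\to B$ with $\beta f=f\alpha$; it is monoidal with $(A,\alpha)\otimes(B,\beta)=(A\otimes B,\alpha\otimes\beta)$, unit $(I,id)$, $\tilde a_{A,B,C}=a_{A,B,C}\circ((\alpha\otimes id_B)\otimes\gamma^{-1})$ for $(C,\gamma)$, $\tilde l_A=\alpha\circ l_A$, $\tilde r_A=\alpha\circ r_A$. If $\mathcal{C}$ is braided with braiding $\tau$, so is $\widetilde{\mathcal{H}}(\mathcal{C})$ with the same $\tau$. A bialgebra $\tilde H$ in $\widetilde{\mathcal{H}}(\mathcal{C})$ is given by a bialgebra $(H,m_H,\eta_H,\Delta_H,\varepsilon_H)$ in $\mathcal{C}$ and a bialgebra automorphism $\alpha$ via $\tilde m_H=\alpha\circ m_H$, $\tilde\Delta_H=\Delta_H\circ\alpha^{-1}$. All structure maps are morphisms in $\widetilde{\mathcal{H}}(\mathcal{C})$. Left module $\psi:H\otimes M\to M$: $\psi(id_H\otimes\psi)\tilde a_{H,H,M}=\psi(\tilde m_H\otimes id_M)$, $\psi(\eta_H\otimes id_M)=\tilde l_M$. Right module $\phi:M\otimes H\to M$: $\phi(\phi\otimes id_H)=\phi(id_M\otimes\tilde m_H)\tilde a_{M,H,H}$, $\phi(id_M\otimes\eta_H)=\tilde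 r_M$. Left comodule $\rho:M\to H\otimes M$: $\tilde a_{H,H,M}(\tilde\Delta_H\otimes id_M)\rho=(id_H\otimes\rho)\rho$, $(\varepsilon_H\otimes id_M)\rho=\tilde l_M^{-1}$. Let $t_{X,Y,Z,W}=\tilde a_{X\otimes Z,Y,W}(\tilde a^{-1}_{X,Z,Y}\otimes id_W)((id_X\otimes\tau_{Y,Z})\otimes id_W)(\tilde a_{X,Y,Z}\otimes id_W)\tilde a^{-1}_{X\otimes Y,Z,W}:(X\otimes Y)\otimes(Z\otimes W)\to(X\otimes Z)\otimes(Y\otimes W)$. The diagonal left action on $H\otimes M$ is $\psi'=(\tilde m_H\otimes\psi)\,t_{H,H,H,M}(\tilde\Delta_H\otimes id_{H\otimes M})$; the diagonal right action on $H\otimes M$ is $\phi'=(\tilde m_H\otimes\phi)\,t_{H,M,H,H}(id_{H\otimes M}\otimes\tilde\Delta_H)$. A left $\tilde H$-Hopf module is a left module and left comodule with $\rho\psi=\psi'(id_H\otimes\rho)$. A left-covariant $\tilde H$-bimodule is an object with a left action $\psi$, a right action $\phi$ and a left coaction $\rho$ such that $\phi(\psi\otimes id_H)\tilde a^{-1}_{H,M,H}=\psi(id_H\otimes\phi)$, $\rho\psi=\psi'(id_H\otimes\rho)$ and $\rho\phi=\phi'(\rho\otimes id_H)$. *)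

(* Defs.v *)
From mathcomp Require Import ssreflect ssrfun.
From mathcomp Require Import boolp.

Set Implicit Arguments.
Unset Strict Implicit.
Unset Printing Implicit Defensive.

Declare Scope cat_scope.
Delimit Scope cat_scope with cat.
Local Open Scope cat_scope.

Reserved Notation "g ∘ f" (at level 40, left associativity).
Reserved Notation "f ⊗ g" (at level 35, no associativity).
Reserved Notation "A ⊠ B" (at level 35, no associativity).

Record category := Category {
  obj :> Type;
  hom : obj -> obj -> Type;
  idm : forall A, hom A A;
  comp : forall A B C, hom B C -> hom A B -> hom A C;
  comp1m : forall A B (f : hom A B), comp (idm B) f = f;
  compm1 : forall A B (f : hom A B), comp f (idm A) = f;
  compA : forall A B C D (h : hom C D) (g : hom B C) (f : hom A B),
    comp h (comp g f) = comp (comp h g) f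
}.

Arguments hom {c}.
Arguments idm {c}.
Arguments comp {c A B C}.

Notation "g ∘ f" := (comp g f) : cat_scope.

Record iso (C : category) (A B : C) := Iso {
  fwd :> hom A B;
  bwd : hom B A;
  fwdK : bwd ∘ fwd = idm A;
  bwdK : fwd ∘ bwd = idm B
}.

Arguments Iso {C A B}.

Notation "f '^i'" := (bwd f) (at level 2, format "f '^i'") : cat_scope.

(* The objects are tensored with [⊠] and the morphisms with [⊗]. *)
Record monoidal := Monoidal {
  mcat :> category;
  tens : mcat -> mcat -> mcat
    where "A ⊠ B" := (tens A B);
  tensm : forall (A A' B B' : mcat),
    hom A A' -> hom B B' -> hom (A ⊠ B) (A' ⊠ B')
    where "f ⊗ g" := (tensm f g);
  munit : mcat;
  asc : forall A B C, iso ((A ⊠ B) ⊠ C) (A ⊠ (B ⊠ C));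
  lun : forall A, iso (munit ⊠ A) A;
  run : forall A, iso (A ⊠ munit) A;
  tensm1 : forall A B, idm A ⊗ idm B = idm (A ⊠ B);
  tensmC : forall (A A' A'' B B' B'' : mcat)
    (f' : hom A' A'') (f : hom A A') (g' : hom B' B'') (g : hom B B'),
    (f' ∘ f) ⊗ (g' ∘ g) = (f' ⊗ g') ∘ (f ⊗ g);
  asc_nat : forall (A A' B B' C C' : mcat)
    (f : hom A A') (g : hom B B') (h : hom C C'),
    asc A' B' C' ∘ ((f ⊗ g) ⊗ h) = (f ⊗ (g ⊗ h)) ∘ asc A B C;
  lun_nat : forall (A A' : mcat) (f : hom A A'),
    lun A' ∘ (idm munit ⊗ f) = f ∘ lun A;
  run_nat : forall (A A' : mcat) (f : hom A A'),
    run A' ∘ (f ⊗ idm munit) = f ∘ run A;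
  pentagon : forall A B C D,
    (idm A ⊗ asc B C D) ∘ asc A (B ⊠ C) D ∘ (asc A B C ⊗ idm D)
      = asc A B (C ⊠ D) ∘ asc (A ⊠ B) C D;
  triangle : forall A B,
    (idm A ⊗ lun B) ∘ asc A munit B = run A ⊗ idm B
}.

Arguments munit {m}.
Arguments asc {m}.
Arguments lun {m}.
Arguments run {m}.

Notation "A ⊠ B" := (tens A B) : cat_scope.
Notation "f ⊗ g" := (tensm f g) : cat_scope.

Record braided := Braided {
  bcat :> monoidal;
  brd : forall A B : bcat, iso (A ⊠ B) (B ⊠ A);
  brd_nat : forall (A A' B B' : bcat) (f : hom A A') (g : hom B B'),
    brd A' B' ∘ (f ⊗ g) = (g ⊗ f) ∘ brd A B;
  hexagon1 : forall A B C : bcat,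
    asc B C A ∘ brd A (B ⊠ C) ∘ asc A B C
      = (idm B ⊗ brd A C) ∘ asc B A C ∘ (brd A B ⊗ idm C);
  hexagon2 : forall A B C : bcat,
    (asc C A B)^i ∘ brd (A ⊠ B) C ∘ (asc A B C)^i
      = (brd A C ⊗ idm B) ∘ (asc A C B)^i ∘ (idm A ⊗ brd B C)
}.

Arguments brd {b}.

Section InBraided.
Variable D : braided.

Definition middle4 (X Y Z W : D) :
    hom ((X ⊠ Y) ⊠ (Z ⊠ W)) ((X ⊠ Z) ⊠ (Y ⊠ W)) :=
  asc (X ⊠ Z) Y W ∘ ((asc X Z Y)^i ⊗ idm W) ∘ ((idm X ⊗ brd Y Z) ⊗ idm W)
    ∘ (asc X Y Z ⊗ idm W) ∘ (asc (X ⊠ Y) Z W)^i.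

Record bialgebra := Bialgebra {
  bobj :> D;
  mul : hom (bobj ⊠ bobj) bobj;
  eta : hom munit bobj;
  comul : hom bobj (bobj ⊠ bobj);
  eps : hom bobj munit;
  mulA : mul ∘ (mul ⊗ idm bobj) = mul ∘ (idm bobj ⊗ mul) ∘ asc _ _ _;
  mul1m : mul ∘ (eta ⊗ idm bobj) = lun bobj;
  mulm1 : mul ∘ (idm bobj ⊗ eta) = run bobj;
  comulA : asc _ _ _ ∘ (comul ⊗ idm bobj) ∘ comul = (idm bobj ⊗ comul) ∘ comul;
  comul1m : (eps ⊗ idm bobj) ∘ comul = (lun bobj)^i;
  comulm1 : (idm bobj ⊗ eps) ∘ comul = (run bobj)^i;
  comul_mul : comul ∘ mul
    = (mul ⊗ mul) ∘ middle4 bobj bobj bobj bobj ∘ (comul ⊗ comul);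
  comul_eta : comul ∘ eta = (eta ⊗ eta) ∘ (lun munit)^i;
  eps_mul : eps ∘ mul = lun munit ∘ (eps ⊗ eps);
  eps_eta : eps ∘ eta = idm munit
}.

Record bialgebra_aut (H : bialgebra) := BialgebraAut {
  baut :> iso H H;
  baut_mul : baut ∘ mul H = mul H ∘ (baut ⊗ baut);
  baut_eta : baut ∘ eta H = eta H;
  baut_comul : comul H ∘ baut = (baut ⊗ baut) ∘ comul H;
  baut_eps : eps H ∘ baut = eps H
}.

Variables (H : bialgebra) (M : D).
Implicit Types (psi : hom (H ⊠ M) M) (phi : hom (M ⊠ H) M)
  (rho : hom M (H ⊠ M)).

Record is_left_module psi : Prop := IsLeftModule {
  lactA : psi ∘ (idm H ⊗ psi) ∘ asc H H M = psi ∘ (mul H ⊗ idm M);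
  lact1 : psi ∘ (eta H ⊗ idm M) = lun M
}.

Record is_right_module phi : Prop := IsRightModule {
  ractA : phi ∘ (phi ⊗ idm H) = phi ∘ (idm M ⊗ mul H) ∘ asc M H H;
  ract1 : phi ∘ (idm M ⊗ eta H) = run M
}.

Record is_left_comodule rho : Prop := IsLeftComodule {
  lcoactA : asc H H M ∘ (comul H ⊗ idm M) ∘ rho = (idm H ⊗ rho) ∘ rho;
  lcoact1 : (eps H ⊗ idm M) ∘ rho = (lun M)^i
}.

Definition diag_left_act psi : hom (H ⊠ (H ⊠ M)) (H ⊠ M) :=
  (mul H ⊗ psi) ∘ middle4 H H H M ∘ (comul H ⊗ idm (H ⊠ M)).

Definition diag_right_act phi : hom ((H ⊠ M) ⊠ H) (H ⊠ M) :=
  (mul H ⊗ phi) ∘ middle4 H M H H ∘ (idm (H ⊠ M) ⊗ comul H).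

Record is_left_Hopf_module psi rho : Prop := IsLeftHopfModule {
  lHopf_act : is_left_module psi;
  lHopf_coact : is_left_comodule rho;
  lHopfE : rho ∘ psi = diag_left_act psi ∘ (idm H ⊗ rho)
}.

Record is_left_covariant_bimodule psi phi rho : Prop :=
    IsLeftCovariantBimodule {
  lcov_Hopf : is_left_Hopf_module psi rho;
  lcov_ract : is_right_module phi;
  lcov_bimod : phi ∘ (psi ⊗ idm H) ∘ (asc H M H)^i = psi ∘ (idm H ⊗ phi);
  lcov_rcov : rho ∘ phi = diag_right_act phi ∘ (rho ⊗ idm H)
}.

End InBraided.

Section Free.
Variables (D : braided) (H : bialgebra D) (V : D).

Definition can_act : hom (H ⊠ (H ⊠ V)) (H ⊠ V) :=
  (mul H ⊗ idm V) ∘ (asc H H V)^i.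

Definition can_coact : hom (H ⊠ V) (H ⊠ (H ⊠ V)) :=
  asc H H V ∘ (comul H ⊗ idm V).

End Free.

(* [tilde C] is the Hom-category of [C]: its objects are pairs (A, alpha) with
   alpha an automorphism of A, its morphisms are the morphisms of [C] commuting
   with the automorphisms, its tensor product, unit and braiding are those of
   [C], but its associator and unitors are twisted by the automorphisms (see
   [tasc_iso], [tlunE] and [trunE]). *)
Section Tilde.
Variable C : braided.

Lemma compKm (A B X : C) (i : iso A B) (f : hom X A) : i^i ∘ (i ∘ f) = f.
Proof. by rewrite compA fwdK comp1m. Qed.

Lemma compVKm (A B X : C) (i : iso A B) (f : hom X B) : i ∘ (i^i ∘ f) = f.
Proof. by rewrite compA bwdK comp1m. Qed.

Lemma compmK (A B X : C) (i : iso A B) (f : hom B X) : (f ∘ i) ∘ i^i = f.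
Proof. by rewrite -compA bwdK compm1. Qed.

Lemma compmVK (A B X : C) (i : iso A B) (f : hom A X) : (f ∘ i^i) ∘ i = f.
Proof. by rewrite -compA fwdK compm1. Qed.

Lemma bwd_comm (A B A' B' : C) (i : iso A B) (j : iso A' B')
    (f : hom A A') (g : hom B B') :
  g ∘ i = j ∘ f -> f ∘ i^i = j^i ∘ g.
Proof. by move=> e; rewrite -[g](compmK i) e -compA compKm. Qed.

Record aobj := AObj { aob : C; aaut : iso aob aob }.

Record ahom (A B : aobj) := AHom {
  amap :> hom (aob A) (aob B);
  amapE : aaut B ∘ amap = amap ∘ aaut A
}.

Lemma ahom_eq (A B : aobj) (f g : ahom A B) : amap f = amap g -> f = g.
Proof.
case: f => f pf; case: g => g pg /= e.
by rewrite -e in pg *; rewrite (Prop_irrelevance pf pg).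
Qed.

Lemma aidm_subproof (A : aobj) : aaut A ∘ idm _ = idm _ ∘ aaut A.
Proof. by rewrite comp1m compm1. Qed.

Definition aidm (A : aobj) : ahom A A := AHom (aidm_subproof A).

Lemma acomp_subproof (X Y Z : aobj) (g : ahom Y Z) (f : ahom X Y) :
  aaut Z ∘ (amap g ∘ amap f) = (amap g ∘ amap f) ∘ aaut X.
Proof. by rewrite compA amapE -!compA amapE. Qed.

Definition acomp (X Y Z : aobj) (g : ahom Y Z) (f : ahom X Y) : ahom X Z :=
  AHom (acomp_subproof g f).

Definition tilde_cat : category.
Proof.
refine (@Category aobj ahom aidm acomp _ _ _).
- abstract (by move=> *; apply: ahom_eq; rewrite /= comp1m).
- abstract (by move=> *; apply: ahom_eq; rewrite /= compm1).
- abstract (by move=> *; apply: ahom_eq; rewrite /= compA).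
Defined.

Definition iso_id (A : C) : iso A A :=
  Iso _ _ (comp1m (idm A)) (compm1 (idm A)).

Definition iso_inv (A B : C) (i : iso A B) : iso B A :=
  Iso _ _ (bwdK i) (fwdK i).

Definition iso_comp (X Y Z : C) (j : iso Y Z) (i : iso X Y) : iso X Z.
Proof.
refine (@Iso C X Z (j ∘ i) (i^i ∘ j^i) _ _).
- abstract (by rewrite -compA compKm fwdK).
- abstract (by rewrite -compA compVKm bwdK).
Defined.

Definition iso_tens (A A' B B' : C) (i : iso A A') (j : iso B B') :
  iso (A ⊠ B) (A' ⊠ B').
Proof.
refine (@Iso C _ _ (i ⊗ j) (i^i ⊗ j^i) _ _).
- abstract (by rewrite -tensmC !fwdK tensm1).
- abstract (by rewrite -tensmC !bwdK tensm1).
Defined.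

Definition atens (A B : tilde_cat) : tilde_cat :=
  AObj (iso_tens (aaut A) (aaut B)).

Definition aunit : tilde_cat := AObj (iso_id munit).

Lemma atensm_subproof (A A' B B' : tilde_cat) (f : hom A A') (g : hom B B') :
  aaut (atens A' B') ∘ (amap f ⊗ amap g)
    = (amap f ⊗ amap g) ∘ aaut (atens A B).
Proof. by rewrite /= -!tensmC !amapE. Qed.

Definition atensm (A A' B B' : tilde_cat) (f : hom A A') (g : hom B B') :
  hom (atens A B) (atens A' B') :=
  @AHom (atens A B) (atens A' B') (amap f ⊗ amap g) (atensm_subproof f g).

Section AIso.
Variables (A B : tilde_cat) (i : iso (aob A) (aob B)).
Variable e : aaut B ∘ i = i ∘ aaut A.

Lemma aiso_subproof : aaut A ∘ i^i = i^i ∘ aaut B.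
Proof. exact: bwd_comm e. Qed.

Definition aiso : iso A B.
Proof.
refine (@Iso tilde_cat A B (@AHom A B i e) (@AHom B A (i^i) aiso_subproof) _ _).
- abstract (by apply: ahom_eq; rewrite /= fwdK).
- abstract (by apply: ahom_eq; rewrite /= bwdK).
Defined.

End AIso.

Definition tasc_iso (A B X : tilde_cat) :
    iso ((aob A ⊠ aob B) ⊠ aob X) (aob A ⊠ (aob B ⊠ aob X)) :=
  iso_comp (asc (aob A) (aob B) (aob X))
    (iso_tens (iso_tens (aaut A) (iso_id (aob B))) (iso_inv (aaut X))).

Lemma tascE (A B X : tilde_cat) :
  aaut (atens A (atens B X)) ∘ tasc_iso A B X
    = tasc_iso A B X ∘ aaut (atens (atens A B) X).
Proof.
by rewrite /= compA -asc_nat -!compA -!tensmC comp1m compm1 fwdK bwdK.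
Qed.

Definition tasc (A B X : tilde_cat) :
  iso (atens (atens A B) X) (atens A (atens B X)) :=
  @aiso (atens (atens A B) X) (atens A (atens B X)) _ (tascE A B X).

Lemma tlunE (A : tilde_cat) :
  aaut A ∘ iso_comp (aaut A) (lun (aob A))
    = iso_comp (aaut A) (lun (aob A)) ∘ aaut (atens aunit A).
Proof. by rewrite /= -!compA lun_nat. Qed.

Definition tlun (A : tilde_cat) : iso (atens aunit A) A :=
  @aiso (atens aunit A) A _ (tlunE A).

Lemma trunE (A : tilde_cat) :
  aaut A ∘ iso_comp (aaut A) (run (aob A))
    = iso_comp (aaut A) (run (aob A)) ∘ aaut (atens A aunit).
Proof. by rewrite /= -!compA run_nat. Qed.

Definition trun (A : tilde_cat) : iso (atens A aunit) A :=
  @aiso (atens A aunit) A _ (trunE A).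

Lemma tens1m (A B B' B'' : C) (g : hom B' B'') (f : hom B B') :
  idm A ⊗ (g ∘ f) = (idm A ⊗ g) ∘ (idm A ⊗ f).
Proof. by rewrite -tensmC comp1m. Qed.

Lemma tensm1r (A B B' B'' : C) (g : hom B' B'') (f : hom B B') :
  (g ∘ f) ⊗ idm A = (g ⊗ idm A) ∘ (f ⊗ idm A).
Proof. by rewrite -tensmC comp1m. Qed.

Lemma tensmlr (A B B' B'' X : C) (f : hom A X) (g : hom B' B'')
    (h : hom B B') :
  (g ∘ h) ⊗ f = (g ⊗ idm X) ∘ (h ⊗ f).
Proof. by rewrite -tensmC comp1m. Qed.

Lemma asc_natl (A A' B B' X X' : C) (f : hom A A') (g : hom B B')
    (h : hom X X') Y (k : hom Y _) :
  (f ⊗ (g ⊗ h)) ∘ (asc A B X ∘ k) = asc A' B' X' ∘ (((f ⊗ g) ⊗ h) ∘ k).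
Proof. by rewrite !compA asc_nat. Qed.

Lemma ascV_nat (A A' B B' X X' : C) (f : hom A A') (g : hom B B')
    (h : hom X X') :
  ((f ⊗ g) ⊗ h) ∘ (asc A B X)^i = (asc A' B' X')^i ∘ (f ⊗ (g ⊗ h)).
Proof. exact/bwd_comm/esym/asc_nat. Qed.

Lemma ascV_natl (A A' B B' X X' : C) (f : hom A A') (g : hom B B')
    (h : hom X X') Y (k : hom Y _) :
  ((f ⊗ g) ⊗ h) ∘ ((asc A B X)^i ∘ k)
    = (asc A' B' X')^i ∘ ((f ⊗ (g ⊗ h)) ∘ k).
Proof. by rewrite !compA ascV_nat. Qed.

Lemma tensmCl (A A' A'' B B' B'' : C)
  (f' : hom A' A'') (f : hom A A') (g' : hom B' B'') (g : hom B B')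
  Y (k : hom Y _) :
    (f' ⊗ g') ∘ ((f ⊗ g) ∘ k) = ((f' ∘ f) ⊗ (g' ∘ g)) ∘ k.
Proof. by rewrite compA tensmC. Qed.

Lemma tilde_pentagon (A B X D : tilde_cat) :
  atensm (idm A) (tasc B X D) ∘ tasc A (atens B X) D
      ∘ atensm (tasc A B X) (idm D)
    = tasc A B (atens X D) ∘ tasc (atens A B) X D.
Proof.
apply: ahom_eq => /=.
rewrite tens1m tensm1r -!compA !asc_natl.
rewrite -[idm (aob B ⊠ aob X)]tensm1 -!tensmC !tensmCl.
rewrite -!tensmC !comp1m !compm1 asc_natl -!tensmC compm1.
rewrite [_ ⊗ ((aaut D)^i ∘ _)]tensmlr !compA pentagon -!compA.
by rewrite comp1m.
Qed.

Lemma tilde_triangle (A B : tilde_cat) :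
  atensm (idm A) (tlun B) ∘ tasc A aunit B = atensm (trun A) (idm B).
Proof.
apply: ahom_eq => /=.
rewrite -lun_nat -run_nat tens1m -compA asc_natl -!tensmC !comp1m bwdK.
by rewrite compA triangle -tensmC comp1m.
Qed.

Definition tilde_monoidal : monoidal.
Proof.
refine (@Monoidal tilde_cat atens atensm aunit tasc tlun trun _ _ _ _ _ _ _).
- abstract (by move=> A B; apply: ahom_eq; rewrite /= tensm1).
- abstract (by move=> *; apply: ahom_eq; rewrite /= tensmC).
- abstract (move=> A A' B B' X X' f g h; apply: ahom_eq;
    rewrite /= compA -asc_nat -!compA -!tensmC comp1m compm1 !amapE;
    by rewrite (bwd_comm (esym (amapE h)))).
- abstract (by move=> A A' f; apply: ahom_eq;
    rewrite /= -compA lun_nat !compA amapE).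
- abstract (by move=> A A' f; apply: ahom_eq;
    rewrite /= -compA run_nat !compA amapE).
- abstract exact: tilde_pentagon.
- abstract exact: tilde_triangle.
Defined.

Definition tbrd (A B : tilde_monoidal) : iso (A ⊠ B) (B ⊠ A) :=
  @aiso (atens A B) (atens B A) (brd (aob A) (aob B))
    (esym (brd_nat (aaut A : hom _ _) (aaut B : hom _ _))).

Lemma tilde_hexagon1 (A B X : tilde_monoidal) :
  asc B X A ∘ tbrd A (B ⊠ X) ∘ asc A B X
    = (idm B ⊗ tbrd A X) ∘ asc B A X ∘ (tbrd A B ⊗ idm X).
Proof.
apply: ahom_eq => /=.
rewrite -!compA [_ ⊗ _ ∘ (brd _ _ ∘ _)]compA -brd_nat -compA asc_natl.
rewrite -!tensmC compm1 comp1m fwdK !compA hexagon1 -!compA.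
by rewrite -!tensmC !comp1m !compm1 brd_nat.
Qed.

Lemma tilde_hexagon2 (A B X : tilde_monoidal) :
  (asc X A B)^i ∘ tbrd (A ⊠ B) X ∘ (asc A B X)^i
    = (tbrd A X ⊗ idm B) ∘ (asc A X B)^i ∘ (idm A ⊗ tbrd B X).
Proof.
apply: ahom_eq => /=.
rewrite -!compA ascV_natl [_ ⊗ (_ ⊗ _) ∘ (brd _ _ ∘ _)]compA -brd_nat -compA.
rewrite tensmCl -!tensmC comp1m compm1 fwdK ascV_nat !compA hexagon2 -!compA.
by rewrite ascV_natl -!tensmC comp1m compm1 brd_nat.
Qed.

Definition tilde : braided.
Proof.
refine (@Braided tilde_monoidal tbrd _ _ _).
- abstract (by move=> *; apply: ahom_eq; rewrite /= brd_nat).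
- abstract exact: tilde_hexagon1.
- abstract exact: tilde_hexagon2.
Defined.

(* A bialgebra of [tilde C] amounts to a bialgebra of [C] together with a
   bialgebra automorphism: [tilde_bialgebra] twists the product and the
   coproduct by the automorphism, and [untwistK] shows that every bialgebra of
   [tilde C] arises in this way. *)
Lemma middle4_tilde (X Y Z W : tilde) :
  amap (middle4 X Y Z W) = middle4 (aob X) (aob Y) (aob Z) (aob W).
Proof.
rewrite /middle4 /= -!compA !tensmCl.
rewrite !comp1m !compm1 fwdK -!tensmC bwdK compm1 -!compA ascV_natl tensmCl.
rewrite -brd_nat comp1m tens1m -compA asc_natl -!tensmC.
by rewrite !(comp1m, compm1) !bwdK !tensm1 compm1.
Qed.

Lemma middle4_nat (X X' Y Y' Z Z' W W' : C) (f : hom X X') (g : hom Y Y')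
    (h : hom Z Z') (k : hom W W') :
  middle4 X' Y' Z' W' ∘ ((f ⊗ g) ⊗ (h ⊗ k))
    = ((f ⊗ h) ⊗ (g ⊗ k)) ∘ middle4 X Y Z W.
Proof.
rewrite /middle4 -!compA !tensmCl asc_natl -ascV_nat !tensmCl.
rewrite !(comp1m, compm1) -!compA ascV_natl asc_nat !tensmCl.
by rewrite brd_nat comp1m compm1.
Qed.

Lemma middle4_natl (X X' Y Y' Z Z' W W' : C) (f : hom X X') (g : hom Y Y')
    (h : hom Z Z') (k : hom W W') S (r : hom S _) T (l : hom _ T) :
  l ∘ middle4 X' Y' Z' W' ∘ (((f ⊗ g) ⊗ (h ⊗ k)) ∘ r)
    = l ∘ ((f ⊗ h) ⊗ (g ⊗ k)) ∘ middle4 X Y Z W ∘ r.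
Proof. by rewrite -[in RHS](compA l) -middle4_nat !compA. Qed.

Section Twist.
Variables (H : bialgebra C) (al : bialgebra_aut H).

Definition tobj : tilde := AObj al.

Lemma tmul_subproof : al ∘ (al ∘ mul H) = (al ∘ mul H) ∘ (al ⊗ al).
Proof. by rewrite -compA baut_mul. Qed.

Definition tmul : hom (tobj ⊠ tobj) tobj :=
  @AHom (tobj ⊠ tobj) tobj (al ∘ mul H) tmul_subproof.

Lemma teta_subproof : al ∘ eta H = eta H ∘ idm munit.
Proof. by rewrite baut_eta compm1. Qed.

Definition teta : hom munit tobj := @AHom aunit tobj (eta H) teta_subproof.

Lemma bautV_comul : comul H ∘ al^i = (al^i ⊗ al^i) ∘ comul H.
Proof.
apply: (@bwd_comm _ _ _ _ al (iso_tens al al)).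
exact: baut_comul.
Qed.

Lemma bautV_mul : mul H ∘ (al^i ⊗ al^i) = al^i ∘ mul H.
Proof.
exact: (@bwd_comm _ _ _ _ (iso_tens al al) al _ _ (esym (baut_mul al))).
Qed.

Lemma bautV_eta : al^i ∘ eta H = eta H.
Proof. by rewrite -[in LHS](baut_eta al) compKm. Qed.

Lemma tcomul_subproof :
  (al ⊗ al) ∘ (comul H ∘ al^i) = (comul H ∘ al^i) ∘ al.
Proof. by rewrite compA -baut_comul compmK compmVK. Qed.

Definition tcomul : hom tobj (tobj ⊠ tobj) :=
  @AHom tobj (tobj ⊠ tobj) (comul H ∘ al^i) tcomul_subproof.

Lemma teps_subproof : idm munit ∘ eps H = eps H ∘ al.
Proof. by rewrite baut_eps comp1m. Qed.

Definition teps : hom tobj munit := @AHom tobj aunit (eps H) teps_subproof.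

Lemma tmulA :
  tmul ∘ (tmul ⊗ idm tobj) = tmul ∘ (idm tobj ⊗ tmul) ∘ asc _ _ _.
Proof.
apply: ahom_eq => /=; rewrite asc_nat compA -[_ ∘ (_ ⊗ (_ ⊗ _))]compA -tensmC.
have -> : al ∘ mul H ∘ (idm H ⊗ al^i) = mul H ∘ (al ⊗ idm H).
  by rewrite baut_mul -compA -tensmC compm1 bwdK.
rewrite comp1m -!compA; congr (_ ∘ _).
have -> : al ⊗ (mul H ∘ (al ⊗ idm H)) = (idm H ⊗ mul H) ∘ (al ⊗ (al ⊗ idm H)).
  by rewrite -tensmC comp1m.
by rewrite -compA -asc_nat !compA -mulA -compA -tensmC baut_mul comp1m.
Qed.

Lemma tcomulA : asc _ _ _ ∘ (tcomul ⊗ idm tobj) ∘ tcomul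
  = (idm tobj ⊗ tcomul) ∘ tcomul.
Proof.
apply: ahom_eq => /=.
rewrite !compA; congr (_ ∘ _).
rewrite bautV_comul -!compA tensmCl tensmCl bwdK comp1m compm1.
have -> : ((idm H ⊗ al^i) ∘ comul H) ⊗ al^i
    = ((idm H ⊗ al^i) ⊗ al^i) ∘ (comul H ⊗ idm H) by rewrite -tensmC compm1.
rewrite -compA compA asc_nat -!compA [asc _ _ _ ∘ _]compA comulA.
by rewrite tensmCl comp1m.
Qed.

Definition tilde_bialgebra : bialgebra tilde.
Proof.
refine (@Bialgebra tilde tobj tmul teta tcomul teps _ _ _ _ _ _ _ _ _ _).
- exact: tmulA.
- abstract (by apply: ahom_eq; rewrite /= -compA mul1m).
- abstract (by apply: ahom_eq; rewrite /= -compA mulm1).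
- exact: tcomulA.
- abstract (by apply: ahom_eq; rewrite /= compA comul1m).
- abstract (by apply: ahom_eq; rewrite /= compA comulm1).
- apply: ahom_eq.
  change ((comul H ∘ al^i) ∘ (al ∘ mul H) = ((al ∘ mul H) ⊗ (al ∘ mul H))
    ∘ amap (middle4 tobj tobj tobj tobj)
    ∘ ((comul H ∘ al^i) ⊗ (comul H ∘ al^i))).
  rewrite middle4_tilde compA compmVK bautV_comul !tensmC.
  rewrite middle4_natl -!tensmC -[al ∘ _ ∘ _]compA bautV_mul compVKm.
  by rewrite comul_mul.
- abstract (by apply: ahom_eq; rewrite /= -compA bautV_eta comul_eta compm1).
- abstract (by apply: ahom_eq; rewrite /= compA baut_eps eps_mul comp1m).
- abstract (by apply: ahom_eq; rewrite /= eps_eta).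
Defined.

End Twist.

Lemma bialgebra_eq (D : braided) (B : D) m m' u u' d d' e e'
    p1 p1' p2 p2' p3 p3' p4 p4' p5 p5' p6 p6' p7 p7' p8 p8' p9 p9' p10 p10' :
  m = m' -> u = u' -> d = d' -> e = e' ->
  @Bialgebra D B m u d e p1 p2 p3 p4 p5 p6 p7 p8 p9 p10
    = @Bialgebra D B m' u' d' e' p1' p2' p3' p4' p5' p6' p7' p8' p9' p10'.
Proof.
move=> em eu ed ee; subst.
by f_equal; apply: Prop_irrelevance.
Qed.

Section Untwist.
Variables (B : bialgebra tilde).
Let H : C := aob (bobj B : aobj).
Let al : iso H H := aaut (bobj B : aobj).

Definition umul : hom (H ⊠ H) H := al^i ∘ amap (mul B).
Definition ucomul : hom H (H ⊠ H) := amap (comul B) ∘ al.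
Definition ueta : hom munit H := amap (eta B).
Definition ueps : hom H munit := amap (eps B).

Lemma umul_aut : al ∘ umul = umul ∘ (al ⊗ al).
Proof. by rewrite compVKm -compA -(amapE (mul B)) compKm. Qed.

Lemma ueta_aut : al ∘ ueta = ueta.
Proof. by rewrite (amapE (eta B)) compm1. Qed.

Lemma ucomul_aut : ucomul ∘ al = (al ⊗ al) ∘ ucomul.
Proof. by rewrite compA (amapE (comul B)). Qed.

Lemma ueps_aut : ueps ∘ al = ueps.
Proof. by rewrite -(amapE (eps B)) comp1m. Qed.

Lemma umulE : umul = amap (mul B) ∘ (al^i ⊗ al^i).
Proof.
apply: (@esym _ _ _ (@bwd_comm _ _ _ _ (iso_tens al al) al _ _ _)).
exact/esym/(amapE (mul B)).
Qed.

Lemma ucomulE : ucomul = (al ⊗ al) ∘ amap (comul B).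
Proof. exact/esym/(amapE (comul B)). Qed.

Lemma umulA :
  umul ∘ (umul ⊗ idm H) = umul ∘ (idm H ⊗ umul) ∘ asc _ _ _.
Proof.
have /= E := congr1 (@amap _ _) (mulA B).
rewrite [X in _ ∘ (X ⊗ _) = _]umulE [X in _ = _ ∘ (_ ⊗ X) ∘ _]umulE.
rewrite tensm1r tens1m /umul -!compA.
rewrite (compA (amap (mul B))) {}E -!compA; do 3 congr (_ ∘ _).
by rewrite -asc_nat -tensmC; congr (_ ∘ (_ ⊗ _)); rewrite -?tensmC;
   rewrite ?bwdK ?compm1 ?comp1m.
Qed.

Lemma ucomulA :
  asc _ _ _ ∘ (ucomul ⊗ idm H) ∘ ucomul = (idm H ⊗ ucomul) ∘ ucomul.
Proof.
have /= E := congr1 (@amap _ _) (comulA B).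
rewrite [X in _ ∘ (X ⊗ _) ∘ _ = _]ucomulE [X in _ = (_ ⊗ X) ∘ _]ucomulE
  tensm1r tens1m /ucomul.
rewrite !compA; congr (_ ∘ _); rewrite -[RHS]compA -{}E !compA; do 2 congr (_ ∘ _).
by rewrite -asc_nat -compA -!tensmC comp1m compm1 bwdK.
Qed.

Lemma ucomul_umul :
  ucomul ∘ umul = (umul ⊗ umul) ∘ middle4 H H H H ∘ (ucomul ⊗ ucomul).
Proof.
have : amap (comul B) ∘ amap (mul B) = (amap (mul B) ⊗ amap (mul B))
    ∘ amap (middle4 (bobj B) (bobj B) (bobj B) (bobj B))
    ∘ (amap (comul B) ⊗ amap (comul B)).
  by have := congr1 (@amap _ _) (comul_mul B).
rewrite middle4_tilde => E.
rewrite [X in _ = (X ⊗ X) ∘ _ ∘ _]umulE [X in _ = _ ∘ (X ⊗ X)]ucomulE.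
rewrite !tensmC middle4_natl.
rewrite -[_ ∘ _ ∘ ((al ⊗ al) ⊗ _)]compA -!tensmC !fwdK !tensm1 !tensmC.
rewrite tensm1 compm1 -E.
by rewrite /ucomul /umul -compA compVKm.
Qed.

Definition untwist : bialgebra C.
Proof.
refine (@Bialgebra C H umul ueta ucomul ueps umulA _ _ ucomulA _ _ _ _ _ _).
- abstract (by have /= E := congr1 (@amap _ _) (mul1m B);
    rewrite /umul -compA E compKm).
- abstract (by have /= E := congr1 (@amap _ _) (mulm1 B);
    rewrite /umul -compA E compKm).
- abstract (by have /= E := congr1 (@amap _ _) (comul1m B);
    rewrite /ucomul compA E compmVK).
- abstract (by have /= E := congr1 (@amap _ _) (comulm1 B);
    rewrite /ucomul compA E compmVK).
- exact: ucomul_umul.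
- abstract (by have /= E := congr1 (@amap _ _) (comul_eta B);
    rewrite /ucomul -compA ueta_aut [LHS]E compm1).
- abstract (by have /= E := congr1 (@amap _ _) (eps_mul B);
    rewrite /umul -[in LHS]ueps_aut -compA compVKm [LHS]E comp1m).
- abstract (by have /= E := congr1 (@amap _ _) (eps_eta B)).
Defined.

Definition untwist_aut : bialgebra_aut untwist :=
  @BialgebraAut C untwist al umul_aut ueta_aut ucomul_aut ueps_aut.

End Untwist.

Lemma untwistK (B : bialgebra tilde) : tilde_bialgebra (untwist_aut B) = B.
Proof.
have m := compVKm (aaut (bobj B : aobj)) (amap (mul B)).
have d := compmK (aaut (bobj B : aobj)) (amap (comul B)).
case: B m d => -[H al] m u d e A1 A2 A3 A4 A5 A6 A7 A8 A9 A10 em ed.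
apply: bialgebra_eq; exact: ahom_eq.
Qed.

End Tilde.

(* Main.v *)
(* The theorem holds over any braided monoidal category, in particular over
   [tilde C].  Left linearity makes Phi on H ⊗ V determined by its restriction
   X = Phi (eta ⊗ 1 ⊗ 1) : V ⊗ H -> H ⊗ V to the coinvariants, and covariance
   under the coaction gives (Delta ⊗ 1) X = (1 ⊗ X) (tau ⊗ 1) (1 ⊗ Delta); applying
   the counit yields X = (1 ⊗ phi) (tau ⊗ 1) (1 ⊗ Delta) with phi = (eps ⊗ 1) X, so
   that Phi is the diagonal action built from phi.

   Coherence is disposed of as follows: a morphism f between tensor products is
   replaced by the natural family f ⊗ id_Z, read between right-nested products
   A1 ⊗ (.. ⊗ (An ⊗ Z)).  Associators and unitors then become identities, and the
   argument is carried out as in a strict monoidal category. *)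

From mathcomp Require Import ssreflect ssrfun.
From mathcomp Require Import boolp.
Require Import Defs.

Set Implicit Arguments.
Unset Strict Implicit.
Unset Printing Implicit Defensive.

Local Open Scope cat_scope.

(** * Right-nested forms of morphisms *)

Section Coherence.
Variable D : braided.

(** A [tree] remembers the bracketing and the units of a tensor word. [flat] forgets both by
    computation, so the two sides of an associator have convertible flattenings and it is meaningful
    for an associator to become an identity. An object does not determine its tree, hence the
    explicit trees in later rewrites. *)
Inductive tree := One | Leaf of D | Node of tree & tree.

Fixpoint tree_obj (t : tree) : D :=
  match t with
  | One => munit
  | Leaf A => A
  | Node s t => tree_obj s ⊠ tree_obj t
  end.

Fixpoint flat (t : tree) (Z : D) : D :=
  match t with
  | One => Z
  | Leaf A => A ⊠ Z
  | Node s t => flat s (flat t Z)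
  end.

Fixpoint fmap (t : tree) (X Y : D) (f : hom X Y) : hom (flat t X) (flat t Y) :=
  match t with
  | One => f
  | Leaf A => idm A ⊗ f
  | Node s t => fmap s (fmap t f)
  end.

Fixpoint flatten (t : tree) (Z : D) : iso (tree_obj t ⊠ Z) (flat t Z) :=
  match t with
  | One => lun Z
  | Leaf A => iso_id (A ⊠ Z)
  | Node s t => iso_comp (flatten s (flat t Z))
      (iso_comp (iso_tens (iso_id (tree_obj s)) (flatten t Z))
        (asc (tree_obj s) (tree_obj t) Z))
  end.

(* [tailed] is locked so that rewriting with associativity does not look inside
   it. *)
Fact tailed_key : unit.
Proof. by []. Qed.

Definition tailed (s t : tree) (f : hom (tree_obj s) (tree_obj t)) (Z : D) :
    hom (flat s Z) (flat t Z) :=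
  locked_with tailed_key (flatten t Z ∘ (f ⊗ idm Z) ∘ (flatten s Z)^i).

Lemma tailedE (s t : tree) (f : hom (tree_obj s) (tree_obj t)) (Z : D) :
  tailed f Z = flatten t Z ∘ (f ⊗ idm Z) ∘ (flatten s Z)^i.
Proof. by rewrite /tailed unlock. Qed.

Lemma iso_monic (A B X : D) (i : iso A B) (f g : hom X A) :
  i ∘ f = i ∘ g -> f = g.
Proof. by move=> e; rewrite -(compKm i f) e compKm. Qed.

Lemma iso_epic (A B X : D) (i : iso A B) (f g : hom B X) :
  f ∘ i = g ∘ i -> f = g.
Proof. by move=> e; rewrite -(compmK i f) e compmK. Qed.

Lemma tens_unitl_inj (A B : D) (f g : hom A B) :
  idm munit ⊗ f = idm munit ⊗ g -> f = g.
Proof. by move=> e; apply: (iso_epic (i := lun A)); rewrite -!lun_nat e. Qed.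

Lemma tens_unitr_inj (A B : D) (f g : hom A B) :
  f ⊗ idm munit = g ⊗ idm munit -> f = g.
Proof. by move=> e; apply: (iso_epic (i := run A)); rewrite -!run_nat e. Qed.

(** Kelly's argument: tensoring with the unit on the left is faithful, and after it the claim
    follows from the pentagon at [munit], [munit], [A], [B] and the triangle. *)
Lemma lun_tens (A B : D) : lun (A ⊠ B) ∘ asc munit A B = lun A ⊗ idm B.
Proof.
apply: tens_unitl_inj.
apply: (iso_epic (i := asc munit (munit ⊠ A) B)).
apply: (iso_epic (i := iso_tens (asc munit munit A) (iso_id B))) => /=.
transitivity (idm munit ⊗ lun (A ⊠ B) ∘ (idm munit ⊗ asc munit A B
    ∘ asc munit (munit ⊠ A) B ∘ (asc munit munit A ⊗ idm B))).
  by rewrite tens1m -!compA.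
rewrite pentagon compA triangle -tensm1 -asc_nat -asc_nat -compA -tensmC.
by rewrite comp1m triangle.
Qed.

Lemma fmap1 (t : tree) (X : D) : fmap t (idm X) = idm _.
Proof.
by elim: t X => [//|A|s IHs t IHt] X /=; rewrite ?tensm1 // IHt IHs.
Qed.

Lemma flatten_nat (t : tree) (X Y : D) (f : hom X Y) :
  flatten t Y ∘ (idm _ ⊗ f) = fmap t f ∘ flatten t X.
Proof.
elim: t X Y f => [|A|s IHs t IHt] X Y f /=.
- exact: lun_nat.
- by rewrite comp1m compm1.
- rewrite [RHS]compA -IHs -!compA -tensm1 asc_nat !tensmCl IHt.
  by rewrite compm1.
Qed.

(** The interchange law as it survives flattening; it is the source of [mulT_nat], [brdT_nat] and
    their companions. *)
Lemma tailed_nat (s t : tree) (f : hom (tree_obj s) (tree_obj t)) (X Y : D)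
    (g : hom X Y) :
  tailed f Y ∘ fmap s g = fmap t g ∘ tailed f X.
Proof.
rewrite !tailedE; apply: (iso_epic (i := flatten s X)).
rewrite -!compA fwdK compm1 -flatten_nat compKm -tensmC compm1 comp1m.
by rewrite compA -flatten_nat -compA -tensmC compm1 comp1m.
Qed.

Lemma tailed_comp (r s t : tree) (g : hom (tree_obj s) (tree_obj t))
    (f : hom (tree_obj r) (tree_obj s)) (Z : D) :
  tailed (s := r) (t := t) (g ∘ f) Z = tailed g Z ∘ tailed f Z.
Proof. by rewrite !tailedE -!compA compKm tensmCl comp1m. Qed.

Lemma tailed_id (t : tree) (Z : D) :
  tailed (s := t) (t := t) (idm _) Z = idm _.
Proof. by rewrite !tailedE tensm1 compm1 bwdK. Qed.

Lemma tailed_tens (s s' t t' : tree) (f : hom (tree_obj s) (tree_obj t))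
    (g : hom (tree_obj s') (tree_obj t')) (Z : D) :
  tailed (s := Node s s') (t := Node t t') (f ⊗ g) Z
    = tailed f (flat t' Z) ∘ fmap s (tailed g Z).
Proof.
apply: (iso_epic (i := flatten (Node s s') Z)).
rewrite {1}tailedE compmVK /= -!compA asc_nat tensmCl comp1m.
rewrite [fmap s _ ∘ _]compA -flatten_nat.
rewrite !tailedE -!compA compKm !tensmCl !comp1m compm1.
by rewrite -!compA fwdK !compm1.
Qed.

Lemma tailed_tens1 (s t r : tree) (f : hom (tree_obj s) (tree_obj t)) (Z : D) :
  tailed (s := Node s r) (t := Node t r) (f ⊗ idm _) Z = tailed f (flat r Z).
Proof. by rewrite tailed_tens tailed_id fmap1 compm1. Qed.

Lemma tailed_1tens (s t r : tree) (f : hom (tree_obj s) (tree_obj t)) (Z : D) :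
  tailed (s := Node r s) (t := Node r t) (idm _ ⊗ f) Z = fmap r (tailed f Z).
Proof. by rewrite tailed_tens tailed_id comp1m. Qed.

(** This is the pentagon whose fourth object is the tail. *)
Lemma tailed_asc (a b c : tree) (Z : D) :
  tailed (s := Node (Node a b) c) (t := Node a (Node b c)) (asc _ _ _) Z
    = idm _.
Proof.
apply: (iso_epic (i := flatten (Node (Node a b) c) Z)).
rewrite comp1m {1}tailedE compmVK /= -!compA.
rewrite !tens1m -!compA -[in RHS]tensm1 -[in RHS]asc_natl.
by rewrite -pentagon -!compA.
Qed.

(** Rests on [lun_tens], as [tailed_run] rests on the triangle. *)
Lemma tailed_lun (t : tree) (Z : D) :
  tailed (s := Node One t) (t := t) (lun _) Z = idm _.
Proof.
apply: (iso_epic (i := flatten (Node One t) Z)).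
by rewrite comp1m {1}tailedE compmVK /= compA lun_nat -compA lun_tens.
Qed.

Lemma tailed_run (t : tree) (Z : D) :
  tailed (s := Node t One) (t := t) (run _) Z = idm _.
Proof.
apply: (iso_epic (i := flatten (Node t One) Z)).
by rewrite comp1m {1}tailedE compmVK /= triangle.
Qed.

Lemma tailed_ascV (a b c : tree) (Z : D) :
  tailed (s := Node a (Node b c)) (t := Node (Node a b) c) (asc _ _ _)^i Z
    = idm _.
Proof.
have := tailed_comp (r := Node a (Node b c)) (s := Node (Node a b) c)
  (t := Node a (Node b c)) (asc _ _ _) (asc _ _ _)^i Z.
by rewrite bwdK tailed_id tailed_asc comp1m.
Qed.

Lemma tailed_lunV (t : tree) (Z : D) :
  tailed (s := t) (t := Node One t) (lun _)^i Z = idm _.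
Proof.
have := tailed_comp (r := t) (s := Node One t) (t := t) (lun _) (lun _)^i Z.
by rewrite bwdK tailed_id tailed_lun comp1m.
Qed.

Lemma tailed_runV (t : tree) (Z : D) :
  tailed (s := t) (t := Node t One) (run _)^i Z = idm _.
Proof.
have := tailed_comp (r := t) (s := Node t One) (t := t) (run _) (run _)^i Z.
by rewrite bwdK tailed_id tailed_run comp1m.
Qed.

(** The tail [munit] suffices: [flatten] is invertible, and the right unitor recovers [f] from
    [f ⊗ idm munit]. This carries flattened equations back to the original ones. *)
Lemma tailed_inj (s t : tree) (f g : hom (tree_obj s) (tree_obj t)) :
  (forall Z, tailed f Z = tailed g Z) -> f = g.
Proof.
move=> e; apply: tens_unitr_inj; have := e munit; rewrite !tailedE => e1.
apply: (iso_monic (i := flatten t munit)).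
exact: (iso_epic (i := iso_inv (flatten s munit))).
Qed.

(** * The braiding in flattened form *)

Definition tailed_brd (a b : tree) (Z : D) :
    hom (flat a (flat b Z)) (flat b (flat a Z)) :=
  tailed (s := Node a b) (t := Node b a) (brd _ _) Z.

Lemma tailed_brd_nat (a a' b b' : tree) (f : hom (tree_obj a) (tree_obj a'))
    (g : hom (tree_obj b) (tree_obj b')) (Z : D) :
  tailed_brd a' b' Z ∘ (tailed f (flat b' Z) ∘ fmap a (tailed g Z))
    = tailed g (flat a' Z) ∘ fmap b (tailed f Z) ∘ tailed_brd a b Z.
Proof.
have /(congr1 (fun k => tailed (s := Node a b) (t := Node b' a') k Z)) :=
  brd_nat f g.
rewrite (tailed_comp (r := Node a b) (s := Node a' b') (t := Node b' a')).
rewrite (tailed_comp (r := Node a b) (s := Node b a) (t := Node b' a')).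
by rewrite !tailed_tens.
Qed.

(** The first hexagon, its associators having become identities; [tailed_brd_nodel] comes from the
    second one in the same way. *)
Lemma tailed_brd_noder (a b c : tree) (Z : D) :
  tailed_brd a (Node b c) Z
    = fmap b (tailed_brd a c Z) ∘ tailed_brd a b (flat c Z).
Proof.
have /(congr1 (fun k => tailed (s := Node (Node a b) c)
    (t := Node b (Node c a)) k Z)) :=
  hexagon1 (tree_obj a) (tree_obj b) (tree_obj c).
rewrite (tailed_comp (s := Node a (Node b c)) (t := Node b (Node c a))).
rewrite (tailed_comp (s := Node (Node b c) a) (t := Node b (Node c a))).
rewrite (tailed_comp (s := Node (Node b a) c) (t := Node b (Node c a))).
rewrite (tailed_comp (s := Node b (Node a c)) (t := Node b (Node c a))).
rewrite !tailed_asc (tailed_1tens (s := Node a c) (t := Node c a)).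
rewrite (tailed_tens1 (s := Node a b) (t := Node b a)).
by rewrite comp1m !compm1.
Qed.

Lemma tailed_brd_nodel (a b c : tree) (Z : D) :
  tailed_brd (Node a b) c Z
    = tailed_brd a c (flat b Z) ∘ fmap a (tailed_brd b c Z).
Proof.
have /(congr1 (fun k => tailed (s := Node a (Node b c))
    (t := Node (Node c a) b) k Z)) :=
  hexagon2 (tree_obj a) (tree_obj b) (tree_obj c).
rewrite (tailed_comp (s := Node (Node a b) c) (t := Node (Node c a) b)).
rewrite (tailed_comp (s := Node c (Node a b)) (t := Node (Node c a) b)).
rewrite (tailed_comp (s := Node a (Node c b)) (t := Node (Node c a) b)).
rewrite (tailed_comp (s := Node (Node a c) b) (t := Node (Node c a) b)).
rewrite !tailed_ascV (tailed_1tens (s := Node b c) (t := Node c b)).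
rewrite (tailed_tens1 (s := Node a c) (t := Node c a)).
by rewrite comp1m !compm1.
Qed.

Definition tailed_iso (s t : tree) (i : iso (tree_obj s) (tree_obj t)) (Z : D) :
    iso (flat s Z) (flat t Z).
Proof.
apply: (Iso (tailed i Z) (tailed i^i Z)).
- by rewrite -tailed_comp fwdK tailed_id.
- by rewrite -tailed_comp bwdK tailed_id.
Defined.

(* The hexagon makes the braiding with the unit idempotent. *)
Lemma tailed_brd1l (b : tree) (Z : D) : tailed_brd One b Z = idm _.
Proof.
apply: (iso_monic
  (i := tailed_iso (s := Node One b) (t := Node b One) (brd _ _) Z)) => /=.
rewrite compm1 -[RHS]/(tailed_brd One b Z).
rewrite -[LHS](tailed_brd_nodel One One b Z).
have := @tailed_brd_nat (Node One One) One b b (lun munit) (idm _) Z.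
rewrite !tailed_id !fmap1 (tailed_lun One) compm1.
by rewrite (tailed_lun One) fmap1 !compm1 !comp1m.
Qed.

Lemma tailed_brd1r (a : tree) (Z : D) : tailed_brd a One Z = idm _.
Proof.
apply: (iso_monic
  (i := tailed_iso (s := Node a One) (t := Node One a) (brd _ _) Z)) => /=.
rewrite compm1 -[RHS]/(tailed_brd a One Z).
rewrite -[LHS](tailed_brd_noder a One One Z).
have := @tailed_brd_nat a a (Node One One) One (idm _) (lun munit) Z.
rewrite !tailed_id !fmap1 (tailed_lun One) fmap1 !compm1.
by rewrite (tailed_lun One) !comp1m.
Qed.

Lemma tailed_middle4 (x y z w : tree) (Z : D) :
  tailed (s := Node (Node x y) (Node z w)) (t := Node (Node x z) (Node y w))
    (middle4 _ _ _ _) Z = fmap x (tailed_brd y z (flat w Z)).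
Proof.
rewrite /middle4.
rewrite (tailed_comp (s := Node (Node (Node x y) z) w)
  (t := Node (Node x z) (Node y w))).
rewrite (tailed_comp (s := Node (Node x (Node y z)) w)
  (t := Node (Node x z) (Node y w))).
rewrite (tailed_comp (s := Node (Node x (Node z y)) w)
  (t := Node (Node x z) (Node y w))).
rewrite (tailed_comp (s := Node (Node (Node x z) y) w)
  (t := Node (Node x z) (Node y w))).
rewrite (tailed_tens1 (s := Node x (Node z y)) (t := Node (Node x z) y)).
rewrite (tailed_tens1 (s := Node x (Node y z)) (t := Node x (Node z y))).
rewrite (tailed_tens1 (s := Node (Node x y) z) (t := Node x (Node y z))).
rewrite (tailed_1tens (s := Node y z) (t := Node z y)).
rewrite (tailed_asc (Node x z) y w) (tailed_asc x y z) tailed_ascV.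
by rewrite (tailed_ascV (Node x y) z w) !comp1m !compm1.
Qed.

End Coherence.

(** * Right actions on a free Hopf module *)

Section FreeRightActions.
Variables (D : braided) (H : bialgebra D) (V : D).

Let tH := Leaf (H : D).
Let tV := Leaf V.

(** * The bialgebra axioms and the braiding with [H] in flattened form *)

Definition mulT Z : hom (H ⊠ (H ⊠ Z)) (H ⊠ Z) :=
  tailed (s := Node tH tH) (t := tH) (mul H) Z.
Definition etaT Z : hom Z (H ⊠ Z) := tailed (s := One D) (t := tH) (eta H) Z.
Definition comulT Z : hom (H ⊠ Z) (H ⊠ (H ⊠ Z)) :=
  tailed (s := tH) (t := Node tH tH) (comul H) Z.
Definition epsT Z : hom (H ⊠ Z) Z := tailed (s := tH) (t := One D) (eps H) Z.
Definition brdT (A B : D) Z : hom (A ⊠ (B ⊠ Z)) (B ⊠ (A ⊠ Z)) :=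
  tailed_brd (Leaf A) (Leaf B) Z.
Definition ractT (phi : hom (V ⊠ H) V) Z : hom (V ⊠ (H ⊠ Z)) (V ⊠ Z) :=
  tailed (s := Node tV tH) (t := tV) phi Z.
Definition fractT (Phi : hom ((H ⊠ V) ⊠ H) (H ⊠ V)) Z :
    hom (H ⊠ (V ⊠ (H ⊠ Z))) (H ⊠ (V ⊠ Z)) :=
  tailed (s := Node (Node tH tV) tH) (t := Node tH tV) Phi Z.

Lemma mulT_nat X Y (f : hom X Y) :
  mulT Y ∘ (idm _ ⊗ (idm _ ⊗ f)) = (idm _ ⊗ f) ∘ mulT X.
Proof. exact: (tailed_nat (s := Node tH tH) (t := tH)). Qed.

Lemma etaT_nat X Y (f : hom X Y) : etaT Y ∘ f = (idm _ ⊗ f) ∘ etaT X.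
Proof. exact: (tailed_nat (s := One D) (t := tH)). Qed.

Lemma comulT_nat X Y (f : hom X Y) :
  comulT Y ∘ (idm _ ⊗ f) = (idm _ ⊗ (idm _ ⊗ f)) ∘ comulT X.
Proof. exact: (tailed_nat (s := tH) (t := Node tH tH)). Qed.

Lemma epsT_nat X Y (f : hom X Y) : epsT Y ∘ (idm _ ⊗ f) = f ∘ epsT X.
Proof. exact: (tailed_nat (s := tH) (t := One D)). Qed.

Lemma brdT_nat A B X Y (f : hom X Y) :
  brdT A B Y ∘ (idm _ ⊗ (idm _ ⊗ f)) = (idm _ ⊗ (idm _ ⊗ f)) ∘ brdT A B X.
Proof.
exact: (tailed_nat (s := Node (Leaf A) (Leaf B)) (t := Node (Leaf B) (Leaf A))).
Qed.

Lemma ractT_nat phi X Y (f : hom X Y) :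
  ractT phi Y ∘ (idm _ ⊗ (idm _ ⊗ f)) = (idm _ ⊗ f) ∘ ractT phi X.
Proof. exact: (tailed_nat (s := Node tV tH) (t := tV)). Qed.

Lemma mulTA Z : mulT Z ∘ mulT (H ⊠ Z) = mulT Z ∘ (idm _ ⊗ mulT Z).
Proof.
have /(congr1 (fun k => tailed (s := Node (Node tH tH) tH) (t := tH) k Z)) :=
  mulA H.
rewrite (tailed_comp (s := Node tH tH)) (tailed_tens1 (s := Node tH tH)).
rewrite (tailed_comp (s := Node tH (Node tH tH))).
rewrite (tailed_comp (s := Node tH tH)).
by rewrite (tailed_1tens (s := Node tH tH)) (tailed_asc tH tH tH) compm1.
Qed.

Lemma mulT1l Z : mulT Z ∘ etaT (H ⊠ Z) = idm _.
Proof.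
have /(congr1 (fun k => tailed (s := Node (One D) tH) (t := tH) k Z)) :=
  mul1m H.
rewrite (tailed_comp (s := Node tH tH)) (tailed_tens1 (s := One D)).
by rewrite (tailed_lun tH).
Qed.

Lemma mulT1r Z : mulT Z ∘ (idm _ ⊗ etaT Z) = idm _.
Proof.
have /(congr1 (fun k => tailed (s := Node tH (One D)) (t := tH) k Z)) :=
  mulm1 H.
rewrite (tailed_comp (s := Node tH tH)) (tailed_1tens (s := One D)).
by rewrite (tailed_run tH).
Qed.

Lemma comulTA Z :
  comulT (H ⊠ Z) ∘ comulT Z = (idm _ ⊗ comulT Z) ∘ comulT Z.
Proof.
have /(congr1 (fun k => tailed (s := tH) (t := Node tH (Node tH tH)) k Z)) :=
  comulA H.
rewrite (tailed_comp (s := Node tH tH)) (tailed_comp (s := Node tH tH)).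
rewrite (tailed_comp (s := Node (Node tH tH) tH)).
rewrite (tailed_tens1 (s := tH)) (tailed_asc tH tH tH) comp1m => ->.
by rewrite (tailed_1tens (s := tH)).
Qed.

Lemma comulT1l Z : epsT (H ⊠ Z) ∘ comulT Z = idm _.
Proof.
have /(congr1 (fun k => tailed (s := tH) (t := Node (One D) tH) k Z)) :=
  comul1m H.
rewrite (tailed_comp (s := Node tH tH)) (tailed_tens1 (s := tH)).
by rewrite (tailed_lunV tH).
Qed.

Lemma comulT1r Z : (idm _ ⊗ epsT Z) ∘ comulT Z = idm _.
Proof.
have /(congr1 (fun k => tailed (s := tH) (t := Node tH (One D)) k Z)) :=
  comulm1 H.
rewrite (tailed_comp (s := Node tH tH)) (tailed_1tens (s := tH)).
by rewrite (tailed_runV tH).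
Qed.

Lemma comulT_mulT Z :
  comulT Z ∘ mulT Z
    = mulT (H ⊠ Z) ∘ (idm _ ⊗ (idm _ ⊗ mulT Z)) ∘ (idm _ ⊗ brdT H H (H ⊠ Z))
        ∘ comulT (H ⊠ (H ⊠ Z)) ∘ (idm _ ⊗ comulT Z).
Proof.
have /(congr1 (fun k => tailed (s := Node tH tH) (t := Node tH tH) k Z)) :=
  comul_mul H.
rewrite (tailed_comp (s := tH)).
rewrite (tailed_comp (s := Node (Node tH tH) (Node tH tH))).
rewrite (tailed_comp (s := Node (Node tH tH) (Node tH tH))).
rewrite (tailed_tens (s := tH) (s' := tH)).
rewrite (tailed_tens (s := Node tH tH) (s' := Node tH tH)).
by rewrite (tailed_middle4 tH tH tH tH) !compA.
Qed.

Lemma comulT_eta Z : comulT Z ∘ etaT Z = etaT (H ⊠ Z) ∘ etaT Z.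
Proof.
have /(congr1 (fun k => tailed (s := One D) (t := Node tH tH) k Z)) :=
  comul_eta H.
rewrite (tailed_comp (s := tH)) (tailed_comp (s := Node (One D) (One D))).
rewrite (tailed_tens (s := One D) (s' := One D)).
by rewrite (tailed_lunV (One D)) compm1.
Qed.

Lemma epsT_mul Z : epsT Z ∘ mulT Z = epsT Z ∘ epsT (H ⊠ Z).
Proof.
have /(congr1 (fun k => tailed (s := Node tH tH) (t := One D) k Z)) :=
  eps_mul H.
rewrite (tailed_comp (s := tH)) (tailed_comp (s := Node (One D) (One D))).
rewrite (tailed_tens (s := tH) (s' := tH)).
by rewrite (tailed_lun (One D)) comp1m -epsT_nat.
Qed.

Lemma epsT_eta Z : epsT Z ∘ etaT Z = idm _.
Proof.
have /(congr1 (fun k => tailed (s := One D) (t := One D) k Z)) := eps_eta H.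
by rewrite (tailed_comp (s := tH)) (tailed_id (One D)).
Qed.

(** Naturality of the braiding in [mul H], the hexagon splitting the braiding past [H ⊠ H] in two.
    The same recipe gives [comulT_brd]; for [eta H] and [eps H] the braiding with the unit is an
    identity. *)
Lemma brdT_mul A Z :
  brdT A H Z ∘ (idm _ ⊗ mulT Z)
    = mulT (A ⊠ Z) ∘ (idm _ ⊗ brdT A H Z) ∘ brdT A H (H ⊠ Z).
Proof.
have := @tailed_brd_nat D (Leaf A) (Leaf A) (Node tH tH) tH (idm _) (mul H) Z.
rewrite !tailed_id fmap1 compm1 comp1m.
by rewrite (tailed_brd_noder (Leaf A) tH tH) compA.
Qed.

Lemma comulT_brd A Z :
  comulT (A ⊠ Z) ∘ brdT A H Z
    = (idm _ ⊗ brdT A H Z) ∘ brdT A H (H ⊠ Z) ∘ (idm _ ⊗ comulT Z).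
Proof.
have := @tailed_brd_nat D (Leaf A) (Leaf A) tH (Node tH tH) (idm _) (comul H) Z.
rewrite !tailed_id fmap1 compm1 comp1m.
by rewrite (tailed_brd_noder (Leaf A) tH tH) => ->.
Qed.

Lemma brdT_eta A Z : brdT A H Z ∘ (idm _ ⊗ etaT Z) = etaT (A ⊠ Z).
Proof.
have := @tailed_brd_nat D (Leaf A) (Leaf A) (One D) tH (idm _) (eta H) Z.
by rewrite !tailed_id compm1 comp1m tailed_brd1r compm1.
Qed.

Lemma brdT_etal A Z : brdT H A Z ∘ etaT (A ⊠ Z) = idm _ ⊗ etaT Z.
Proof.
have := @tailed_brd_nat D (One D) tH (Leaf A) (Leaf A) (eta H) (idm _) Z.
by rewrite !tailed_id compm1 comp1m tailed_brd1l compm1.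
Qed.

Lemma epsT_brd A Z : epsT (A ⊠ Z) ∘ brdT A H Z = idm _ ⊗ epsT Z.
Proof.
have := @tailed_brd_nat D (Leaf A) (Leaf A) tH (One D) (idm _) (eps H) Z.
by rewrite !tailed_id /= tensm1 compm1 comp1m tailed_brd1r comp1m.
Qed.

Lemma brdT_ract phi Z :
  brdT V H Z ∘ ractT phi (H ⊠ Z)
    = (idm _ ⊗ ractT phi Z) ∘ brdT V H (H ⊠ Z) ∘ (idm _ ⊗ brdT H H Z).
Proof.
have := @tailed_brd_nat D (Node tV tH) tV tH tH phi (idm _) Z.
rewrite !tailed_id fmap1 compm1 comp1m.
by rewrite (tailed_brd_nodel tV tH tH) => ->; exact: compA.
Qed.

(** * Module, bimodule and covariance conditions in flattened form *)

Lemma tailed_right_module (t : tree D)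
    (phi : hom (tree_obj t ⊠ H) (tree_obj t)) (p := tailed (s := Node t tH) phi) :
  is_right_module phi <->
  (forall Z, p Z ∘ p (H ⊠ Z) = p Z ∘ fmap t (mulT Z)) /\
  (forall Z, p Z ∘ fmap t (etaT Z) = idm _).
Proof.
have tA Z : tailed (s := Node (Node t tH) tH) (t := t)
    (phi ∘ (phi ⊗ idm H)) Z = p Z ∘ p (H ⊠ Z).
  by rewrite (tailed_comp (s := Node t tH)) (tailed_tens1 (s := Node t tH)).
have tM Z : tailed (s := Node (Node t tH) tH) (t := t)
    (phi ∘ (idm _ ⊗ mul H) ∘ asc _ _ _) Z = p Z ∘ fmap t (mulT Z).
  rewrite (tailed_comp (s := Node t (Node tH tH))) (tailed_asc t tH tH) compm1.
  by rewrite (tailed_comp (s := Node t tH)) (tailed_1tens (s := Node tH tH)).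
have tE Z : tailed (s := Node t (One D)) (t := t)
    (phi ∘ (idm _ ⊗ eta H)) Z = p Z ∘ fmap t (etaT Z).
  by rewrite (tailed_comp (s := Node t tH)) (tailed_1tens (s := One D)).
split=> [[hA h1]|[hA h1]]; split.
- by move=> Z; rewrite -tA -tM hA.
- by move=> Z; rewrite -tE h1 tailed_run.
- by apply: (tailed_inj (s := Node (Node t tH) tH)) => Z; rewrite tA tM hA.
- apply: (tailed_inj (s := Node t (One D)) (t := t)) => Z.
  by rewrite tE h1 tailed_run.
Qed.

Lemma tailed_can_act Z :
  tailed (s := Node tH (Node tH tV)) (t := Node tH tV) (can_act H V) Z
    = mulT (V ⊠ Z).
Proof.
rewrite (tailed_comp (s := Node (Node tH tH) tV)).
by rewrite (tailed_ascV tH tH tV) compm1 (tailed_tens1 (s := Node tH tH)).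
Qed.

Lemma tailed_can_coact Z :
  tailed (s := Node tH tV) (t := Node tH (Node tH tV)) (can_coact H V) Z
    = comulT (V ⊠ Z).
Proof.
rewrite (tailed_comp (s := Node (Node tH tH) tV)).
by rewrite (tailed_asc tH tH tV) comp1m (tailed_tens1 (s := tH)).
Qed.

(** Once flattened, each axiom is a bialgebra axiom with [V] absorbed into the tail; compatibility
    of action and coaction is [comulT_mulT]. *)
Lemma free_Hopf_module : is_left_Hopf_module (can_act H V) (can_coact H V).
Proof.
split; [split | split |].
- apply: (tailed_inj (s := Node (Node tH tH) (Node tH tV)) (t := Node tH tV)).
  move=> Z.
  rewrite (tailed_comp (s := Node tH (Node tH (Node tH tV)))).
  rewrite (tailed_comp (s := Node tH (Node tH tV))).
  rewrite (tailed_asc tH tH (Node tH tV)) compm1.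
  rewrite (tailed_1tens (s := Node tH (Node tH tV)) (t := Node tH tV)).
  rewrite (tailed_comp (s := Node tH (Node tH tV))).
  rewrite (tailed_tens1 (s := Node tH tH) (Node tH tV)).
  by rewrite !tailed_can_act; apply/esym/mulTA.
- apply: (tailed_inj (s := Node (One D) (Node tH tV)) (t := Node tH tV)) => Z.
  rewrite (tailed_comp (s := Node tH (Node tH tV))).
  rewrite (tailed_tens1 (s := One D) (Node tH tV)).
  by rewrite (tailed_lun (Node tH tV)) tailed_can_act; apply: mulT1l.
- apply: (tailed_inj (s := Node tH tV) (t := Node tH (Node tH (Node tH tV)))).
  move=> Z.
  rewrite (tailed_comp (s := Node tH (Node tH tV))).
  rewrite (tailed_comp (s := Node (Node tH tH) (Node tH tV))).
  rewrite (tailed_asc tH tH (Node tH tV)) comp1m.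
  rewrite (tailed_tens1 (s := tH) (Node tH tV)).
  rewrite (tailed_comp (s := Node tH (Node tH tV))).
  rewrite (tailed_1tens (s := Node tH tV) (t := Node tH (Node tH tV))).
  by rewrite !tailed_can_coact; apply: comulTA.
- apply: (tailed_inj (s := Node tH tV) (t := Node (One D) (Node tH tV))) => Z.
  rewrite (tailed_comp (s := Node tH (Node tH tV))).
  rewrite (tailed_tens1 (s := tH) (Node tH tV)).
  by rewrite (tailed_lunV (Node tH tV)) tailed_can_coact; apply: comulT1l.
- apply: (tailed_inj (s := Node tH (Node tH tV)) (t := Node tH (Node tH tV))).
  move=> Z.
  rewrite (tailed_comp (s := Node tH tV)) tailed_can_act tailed_can_coact.
  rewrite (tailed_comp (s := Node tH (Node tH (Node tH tV)))).
  rewrite (tailed_comp (s := Node (Node tH tH) (Node tH (Node tH tV)))).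
  rewrite (tailed_comp (s := Node (Node tH tH) (Node tH (Node tH tV)))).
  rewrite (tailed_tens1 (s := tH) (Node tH (Node tH tV))).
  rewrite (tailed_middle4 tH tH tH (Node tH tV)).
  rewrite (tailed_tens (s := Node tH tH) (s' := Node tH (Node tH tV))
    (t := tH) (t' := Node tH tV)).
  rewrite (tailed_1tens (s := Node tH tV) (t := Node tH (Node tH tV))).
  by rewrite tailed_can_act tailed_can_coact; apply: comulT_mulT.
Qed.

Lemma tailed_bimod (Phi : hom ((H ⊠ V) ⊠ H) (H ⊠ V)) :
  Phi ∘ (can_act H V ⊗ idm H) ∘ (asc _ _ _)^i = can_act H V ∘ (idm H ⊗ Phi)
  <-> forall Z, fractT Phi Z ∘ mulT (V ⊠ (H ⊠ Z))
        = mulT (V ⊠ Z) ∘ (idm _ ⊗ fractT Phi Z).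
Proof.
have tl Z : tailed (s := Node tH (Node (Node tH tV) tH)) (t := Node tH tV)
    (Phi ∘ (can_act H V ⊗ idm H) ∘ (asc _ _ _)^i) Z
    = fractT Phi Z ∘ mulT (V ⊠ (H ⊠ Z)).
  rewrite (tailed_comp (s := Node (Node tH (Node tH tV)) tH)).
  rewrite (tailed_ascV tH (Node tH tV) tH) compm1.
  rewrite (tailed_comp (s := Node (Node tH tV) tH)).
  rewrite (tailed_tens1 (s := Node tH (Node tH tV)) (t := Node tH tV)).
  by rewrite tailed_can_act.
have tr Z : tailed (s := Node tH (Node (Node tH tV) tH)) (t := Node tH tV)
    (can_act H V ∘ (idm H ⊗ Phi)) Z = mulT (V ⊠ Z) ∘ (idm _ ⊗ fractT Phi Z).
  rewrite (tailed_comp (s := Node tH (Node tH tV))) tailed_can_act.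
  by rewrite (tailed_1tens (s := Node (Node tH tV) tH) (t := Node tH tV)).
split=> [e Z|e]; first by rewrite -tl e tr.
apply: (tailed_inj (s := Node tH (Node (Node tH tV) tH)) (t := Node tH tV)) => Z.
by rewrite tl tr e.
Qed.

(** The flattened diagonal action on [H ⊠ (H ⊠ V)], with the braiding of [H ⊠ V] past [H] split by
    the second hexagon. *)
Definition diag_fractT (Phi : hom ((H ⊠ V) ⊠ H) (H ⊠ V)) Z :
    hom (H ⊠ (H ⊠ (V ⊠ (H ⊠ Z)))) (H ⊠ (H ⊠ (V ⊠ Z))) :=
  mulT (H ⊠ (V ⊠ Z)) ∘ (idm _ ⊗ (idm _ ⊗ fractT Phi Z))
    ∘ (idm _ ⊗ (brdT H H (V ⊠ (H ⊠ Z)) ∘ (idm _ ⊗ brdT V H (H ⊠ Z))))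
    ∘ (idm _ ⊗ (idm _ ⊗ (idm _ ⊗ comulT Z))).

Lemma tailed_rcov (Phi : hom ((H ⊠ V) ⊠ H) (H ⊠ V)) :
  can_coact H V ∘ Phi = diag_right_act Phi ∘ (can_coact H V ⊗ idm H)
  <-> forall Z, comulT (V ⊠ Z) ∘ fractT Phi Z
        = diag_fractT Phi Z ∘ comulT (V ⊠ (H ⊠ Z)).
Proof.
have tl Z : tailed (s := Node (Node tH tV) tH) (t := Node tH (Node tH tV))
    (can_coact H V ∘ Phi) Z = comulT (V ⊠ Z) ∘ fractT Phi Z.
  by rewrite (tailed_comp (s := Node tH tV)) tailed_can_coact.
have tr Z : tailed (s := Node (Node tH tV) tH) (t := Node tH (Node tH tV))
    (diag_right_act Phi ∘ (can_coact H V ⊗ idm H)) Z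
    = diag_fractT Phi Z ∘ comulT (V ⊠ (H ⊠ Z)).
  rewrite (tailed_comp (s := Node (Node tH (Node tH tV)) tH)).
  rewrite (tailed_tens1 (s := Node tH tV) (t := Node tH (Node tH tV))).
  rewrite tailed_can_coact.
  rewrite (tailed_comp (s := Node (Node tH (Node tH tV)) (Node tH tH))).
  rewrite (tailed_comp (s := Node (Node tH tH) (Node (Node tH tV) tH))).
  rewrite (tailed_1tens (s := tH) (t := Node tH tH)).
  rewrite (tailed_middle4 tH (Node tH tV) tH tH).
  rewrite (tailed_tens (s := Node tH tH) (s' := Node (Node tH tV) tH)
    (t := tH) (t' := Node tH tV)).
  by rewrite (tailed_brd_nodel tH tV tH).
split=> [e Z|e]; first by rewrite -tl e tr.
apply: (tailed_inj (s := Node (Node tH tV) tH) (t := Node tH (Node tH tV))) => Z.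
by rewrite tl tr e.
Qed.

(** * From right actions on [V] to right actions on [H ⊠ V] *)

Definition crossT (phi : hom (V ⊠ H) V) Z : hom (V ⊠ (H ⊠ Z)) (H ⊠ (V ⊠ Z)) :=
  (idm _ ⊗ ractT phi Z) ∘ brdT V H (H ⊠ Z) ∘ (idm _ ⊗ comulT Z).

(** [crossT phi] is the map X built from [phi]. The leading factor [H] enters only through a left
    multiplication, which is what makes the diagonal action left linear. *)
Lemma tailed_diag_right_act (phi : hom (V ⊠ H) V) Z :
  fractT (diag_right_act phi) Z = mulT (V ⊠ Z) ∘ (idm _ ⊗ crossT phi Z).
Proof.
rewrite /fractT.
rewrite (tailed_comp (s := Node (Node tH tV) (Node tH tH))).
rewrite (tailed_comp (s := Node (Node tH tH) (Node tV tH))).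
rewrite (tailed_1tens (s := tH) (t := Node tH tH)).
rewrite (tailed_middle4 tH tV tH tH).
rewrite (tailed_tens (s := Node tH tH) (s' := Node tV tH)).
by rewrite /crossT !tens1m !compA.
Qed.

(** Include [V] as the coinvariants [1 ⊗ V], act by [Phi], and project back by the counit. *)
Definition coinv_ract (Phi : hom ((H ⊠ V) ⊠ H) (H ⊠ V)) : hom (V ⊠ H) V :=
  lun V ∘ (eps H ⊗ idm V) ∘ Phi ∘ (((eta H ⊗ idm V) ∘ (lun V)^i) ⊗ idm H).

Lemma tailed_coinv_ract Phi Z :
  ractT (coinv_ract Phi) Z
    = epsT (V ⊠ Z) ∘ fractT Phi Z ∘ etaT (V ⊠ (H ⊠ Z)).
Proof.
rewrite /ractT.
rewrite (tailed_comp (s := Node (Node tH tV) tH)).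
rewrite (tailed_tens1 (s := tV) (t := Node tH tV)).
rewrite (tailed_comp (s := Node (One D) tV)) (tailed_lunV tV) compm1.
rewrite (tailed_tens1 (s := One D)).
rewrite (tailed_comp (s := Node tH tV)) (tailed_comp (s := Node (One D) tV)).
by rewrite (tailed_lun tV) comp1m (tailed_tens1 (s := tH)).
Qed.

(** This rule and the next two apply an equation in the middle of a right-associated composite, or
    behind a spectator factor on the left. *)
Lemma comp_eql (A B B' X : D) (g : hom B X) (f : hom A B) (g' : hom B' X)
    (f' : hom A B') :
  g ∘ f = g' ∘ f' -> forall Y (k : hom Y A), g ∘ (f ∘ k) = g' ∘ (f' ∘ k).
Proof. by move=> e Y k; rewrite !compA e. Qed.

Lemma comp_eql1 (A B : D) (g : hom B A) (f : hom A B) :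
  g ∘ f = idm A -> forall Y (k : hom Y A), g ∘ (f ∘ k) = k.
Proof. by move=> e Y k; rewrite compA e comp1m. Qed.

Lemma whisker_eq (A X Y Y' Z : D) (g : hom Y Z) (f : hom X Y) (g' : hom Y' Z)
    (f' : hom X Y') :
  g ∘ f = g' ∘ f' ->
  (idm A ⊗ g) ∘ (idm A ⊗ f) = (idm A ⊗ g') ∘ (idm A ⊗ f').
Proof. by move=> e; rewrite -!tens1m e. Qed.

(** The coproduct slides past [phi] and through the braiding onto the argument in [H], where
    coassociativity regroups the two nested coproducts. *)
Lemma comulT_cross phi Z :
  comulT (V ⊠ Z) ∘ crossT phi Z
    = (idm _ ⊗ crossT phi Z) ∘ (brdT V H (H ⊠ Z) ∘ (idm _ ⊗ comulT Z)).
Proof.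
rewrite /crossT -!compA (comp_eql (comulT_nat (ractT phi Z))).
rewrite (comp_eql (comulT_brd V (H ⊠ Z))) -!compA.
rewrite (whisker_eq V (comulTA Z)) (comp_eql (brdT_nat V H (comulT Z))).
by rewrite !tens1m -!compA.
Qed.

(** The coproduct of a product is the product of the coproducts. Its left legs multiply outside the
    braiding, and its right legs act one after the other by associativity of [phi]. *)
Lemma crossT_mul phi Z : is_right_module phi ->
  crossT phi Z ∘ (idm _ ⊗ mulT Z)
    = mulT (V ⊠ Z) ∘ ((idm _ ⊗ crossT phi Z) ∘ crossT phi (H ⊠ Z)).
Proof.
move=> /(tailed_right_module (t := tV) phi) [phiA _].
have {}phiA : ractT phi Z ∘ ractT phi (H ⊠ Z) = ractT phi Z ∘ (idm _ ⊗ mulT Z).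
  exact: phiA.
rewrite /crossT !tens1m -!compA -tens1m comulT_mulT !tens1m -!compA.
(* The product of the left legs is carried through the braiding and becomes the outermost [mulT]. *)
rewrite (comp_eql (brdT_mul V (H ⊠ Z))) -!compA.
rewrite -(comp_eql (mulT_nat (ractT phi Z))); congr (_ ∘ _).
rewrite (comp_eql (brdT_nat V H (idm H ⊗ mulT Z))).
rewrite (comp_eql (whisker_eq H (brdT_nat V H (mulT Z)))).
rewrite -(comp_eql (whisker_eq H (whisker_eq H phiA))); congr (_ ∘ _).
rewrite -(comp_eql (whisker_eq H (ractT_nat phi (comulT Z)))).
(* On the right-hand side the first action precedes the second braiding. Exchanging them costs a
   braiding of [H] with [H], which is the one in the coproduct of a product. *)
rewrite (comp_eql (whisker_eq H (brdT_ract phi (H ⊠ Z)))) tens1m -!compA.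
congr (_ ∘ (_ ∘ _)).
rewrite -(comp_eql (brdT_nat V H (idm H ⊗ comulT Z))).
rewrite (whisker_eq V (comulT_nat (comulT Z))).
by rewrite (comp_eql (brdT_nat V H (brdT H H (H ⊠ Z)))).
Qed.

Lemma crossT_eta phi Z : is_right_module phi ->
  crossT phi Z ∘ (idm _ ⊗ etaT Z) = etaT (V ⊠ Z).
Proof.
move=> /(tailed_right_module (t := tV) phi) [_ phi1].
have {}phi1 : ractT phi Z ∘ (idm _ ⊗ etaT Z) = idm _ by exact: phi1.
rewrite /crossT -!compA -tens1m comulT_eta.
rewrite tens1m (compA (brdT _ _ _)) brdT_eta.
by rewrite compA -etaT_nat -compA phi1 compm1.
Qed.

(** With the action written as multiplication after X, associativity of [mul H] merges the two
    products, leaving [crossT_mul] and [crossT_eta]. *)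
Lemma diag_right_module phi : is_right_module phi ->
  is_right_module (diag_right_act phi : hom ((H ⊠ V) ⊠ H) (H ⊠ V)).
Proof.
move=> phiP; apply/(tailed_right_module (t := Node tH tV)); split=> Z.
- rewrite -/(fractT _ Z) -/(fractT _ (H ⊠ Z)) /= !tailed_diag_right_act.
  rewrite -!compA (comp_eql (esym (mulT_nat (crossT phi Z)))).
  rewrite (comp_eql (mulTA (V ⊠ Z))) -!tens1m.
  by rewrite crossT_mul // !tens1m.
- rewrite -/(fractT _ Z) /= tailed_diag_right_act -compA -tens1m.
  by rewrite crossT_eta // mulT1r.
Qed.

Lemma diag_left_covariant phi : is_right_module phi ->
  is_left_covariant_bimodule (can_act H V)
    (diag_right_act phi : hom ((H ⊠ V) ⊠ H) (H ⊠ V)) (can_coact H V).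
Proof.
move=> phiP; split.
- exact: free_Hopf_module.
- exact: diag_right_module.
- apply/tailed_bimod => Z; rewrite tailed_diag_right_act -!compA.
  by rewrite -mulT_nat (comp_eql (mulTA (V ⊠ Z))) tens1m.
(* Covariance combines multiplicativity of the coproduct with [comulT_cross]; the rest is reordering
   by naturality. *)
- apply/tailed_rcov => Z; rewrite /diag_fractT !tailed_diag_right_act.
  rewrite compA comulT_mulT -!compA (whisker_eq H (comulT_cross phi Z)).
  rewrite ![idm H ⊗ (brdT _ _ _ ∘ _)]tens1m [idm H ⊗ (mulT _ ∘ _)]tens1m.
  rewrite [idm H ⊗ (_ ∘ (idm H ⊗ (idm H ⊗ crossT _ _)))]tens1m -!compA.
  rewrite (comp_eql (comulT_nat (idm H ⊗ crossT phi Z))).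
  rewrite (comp_eql (comulT_nat (brdT V H (H ⊠ Z)))).
  rewrite (comulT_nat (idm V ⊗ comulT Z)).
  by rewrite (comp_eql (whisker_eq H (brdT_nat H H (crossT phi Z)))).
Qed.

Lemma ract_inj (phi psi : hom (V ⊠ H) V) :
  (forall Z, ractT phi Z = ractT psi Z) -> phi = psi.
Proof. exact: (tailed_inj (s := Node tV tH) (t := tV)). Qed.

Lemma fract_inj (Phi Psi : hom ((H ⊠ V) ⊠ H) (H ⊠ V)) :
  (forall Z, fractT Phi Z = fractT Psi Z) -> Phi = Psi.
Proof. exact: (tailed_inj (s := Node (Node tH tV) tH) (t := Node tH tV)). Qed.

(** The counit is multiplicative and cancels the inserted unit; it then passes the braiding and
    cancels the left leg of the coproduct. *)
Lemma diag_ractK (phi : hom (V ⊠ H) V) : coinv_ract (diag_right_act phi) = phi.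
Proof.
apply: ract_inj => Z.
rewrite tailed_coinv_ract tailed_diag_right_act -!compA -etaT_nat.
rewrite (comp_eql (epsT_mul (V ⊠ Z))) (comp_eql1 (epsT_eta _)) /crossT -!compA.
rewrite (comp_eql (epsT_nat _)) (compA (epsT _)) epsT_brd -tens1m comulT1l.
by rewrite tensm1 compm1.
Qed.

(** * From left-covariant bimodules to right actions on [V] *)

Section LeftCovariant.
Variable Phi : hom ((H ⊠ V) ⊠ H) (H ⊠ V).
Hypothesis PhiP : is_left_covariant_bimodule (can_act H V) Phi (can_coact H V).

Definition coinv_crossT Z : hom (V ⊠ (H ⊠ Z)) (H ⊠ (V ⊠ Z)) :=
  fractT Phi Z ∘ etaT (V ⊠ (H ⊠ Z)).

(** In elements, [h ⊗ v] is [h] acting on [1 ⊗ v], so left linearity pulls [h] out of [Phi]. *)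
Lemma fractT_cross Z : fractT Phi Z = mulT (V ⊠ Z) ∘ (idm _ ⊗ coinv_crossT Z).
Proof.
rewrite tens1m compA -((tailed_bimod Phi).1 (lcov_bimod PhiP)).
by rewrite -compA mulT1r compm1.
Qed.

(** The coaction sends [1 ⊗ v] to [1 ⊗ (1 ⊗ v)]. In the diagonal action the first unit is absorbed
    by the product, and the second passes the braiding and restores X. *)
Lemma comulT_coinv_cross Z :
  comulT (V ⊠ Z) ∘ coinv_crossT Z
    = (idm _ ⊗ coinv_crossT Z) ∘ (brdT V H (H ⊠ Z) ∘ (idm _ ⊗ comulT Z)).
Proof.
rewrite /coinv_crossT compA ((tailed_rcov Phi).1 (lcov_rcov PhiP)).
rewrite /diag_fractT !tens1m -!compA comulT_eta.
rewrite -!(comp_eql (etaT_nat _)).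
rewrite (comp_eql1 (mulT1l _)) -etaT_nat -(comp_eql (etaT_nat _)).
by rewrite (compA (brdT H H _)) brdT_etal.
Qed.

(** Apply the counit to the middle factor in [comulT_coinv_cross]: one side collapses to X, the
    other is the crossing built from [coinv_ract Phi]. *)
Lemma crossT_coinv Z : crossT (coinv_ract Phi) Z = coinv_crossT Z.
Proof.
rewrite /crossT tailed_coinv_ract -[_ ∘ etaT _]compA -/(coinv_crossT Z).
rewrite tens1m -!compA -comulT_coinv_cross compA.
by rewrite comulT1r comp1m.
Qed.

Lemma coinv_ractK : diag_right_act (coinv_ract Phi) = Phi.
Proof.
apply: fract_inj => Z.
by rewrite tailed_diag_right_act crossT_coinv -fractT_cross.
Qed.

Lemma coinv_right_module : is_right_module (coinv_ract Phi).
Proof.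
have [A E] := (tailed_right_module (t := Node tH tV) Phi).1 (lcov_ract PhiP).
have {}A Z : fractT Phi Z ∘ fractT Phi (H ⊠ Z)
    = fractT Phi Z ∘ (idm _ ⊗ (idm _ ⊗ mulT Z)) by exact: A.
have {}E Z : fractT Phi Z ∘ (idm _ ⊗ (idm _ ⊗ etaT Z)) = idm _ by exact: E.
apply/(tailed_right_module (t := tV)); split=> Z.
- rewrite -/(ractT _ Z) -/(ractT _ (H ⊠ Z)) /= !tailed_coinv_ract -!compA.
  rewrite (etaT_nat (idm V ⊗ mulT Z)) -(comp_eql (A Z)).
  (* Associativity of [Phi] has produced [Phi] twice. Multiplicativity of the counit rewrites [eps]
     after the outer [Phi] as [eps] after X after [eps], which inserts the counit between the two
     actions. *)
  rewrite [fractT Phi Z in RHS]fractT_cross -!compA (comp_eql (epsT_mul (V ⊠ Z))).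
  by rewrite (comp_eql (epsT_nat (coinv_crossT Z))) /coinv_crossT -!compA.
- rewrite -/(ractT _ Z) /= tailed_coinv_ract -!compA etaT_nat.
  by rewrite (compA (fractT _ _)) E comp1m epsT_eta.
Qed.

End LeftCovariant.
End FreeRightActions.

(** * The bijection *)

Lemma left_covariant_bij (D : braided) (H : bialgebra D) (V : D) :
  exists f :
    {phi : hom ((H ⊠ V) ⊠ H) (H ⊠ V) |
      is_left_covariant_bimodule (can_act H V) phi (can_coact H V)} ->
    {phi : hom (V ⊠ H) V | is_right_module phi},
  bijective f.
Proof.
pose f (p : {phi : hom ((H ⊠ V) ⊠ H) (H ⊠ V) |
    is_left_covariant_bimodule (can_act H V) phi (can_coact H V)}) :=
  exist (@is_right_module D H V) _ (coinv_right_module (proj2_sig p)).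
pose g (p : {phi : hom (V ⊠ H) V | is_right_module phi}) :=
  exist (fun phi => is_left_covariant_bimodule (can_act H V) phi (can_coact H V))
    _ (diag_left_covariant (proj2_sig p)).
(* Proof components are irrelevant, so only the underlying actions have to be compared. *)
exists f; exists g => -[phi phiP]; apply: eq_exist => /=.
- exact: coinv_ractK.
- exact: diag_ractK.
Qed.

Theorem theorem3p5 (C : braided) (H : bialgebra (tilde C)) (V : tilde C) :
  exists f :
    {phi : hom ((H ⊠ V) ⊠ H) (H ⊠ V) |
      is_left_covariant_bimodule (can_act H V) phi (can_coact H V)} ->
    {phi : hom (V ⊠ H) V | is_right_module phi},
  bijective f.
(* The twists sit in the associators and unitors of [tilde C] and in the structure maps of [H], all
   of which the general result treats as arbitrary. *)
Proof. exact: left_covariant_bij. Qed.
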